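(* Let $\mathcal{H}$ be a real Hilbert space, let $x\in\mathcal{H}$, and for $i=1,\dots,k$ let $f_i:\mathcal{H}\to\mathbb{R}$ be locally Lipschitz near $x$. Let $(\varepsilon_j)_j$ be a sequence of positive numbers converging to $0$. Let $(x_j)_j$ and $(\xi_j)_j$ be sequences in $\mathcal{H}$ and $\mathcal{H}^*$, respectively, such that $(x_j)_j$ converges (in norm) to $x$ and $(\xi_j)_j$ converges weakly in $\mathcal{H}^*$ to $\xi$. Assume further that $\xi_j\in F_{\varepsilon_j}(x_j)$ for all $j\ge 1$. Then $$\xi\in F_0(x)=\operatorname{conv}\Big(\bigcup_{i=1}^k\partial f_i(x)\Big).$$
   Context: $\mathcal{H}^*$ is the topological dual of $\mathcal{H}$ with the dual norm. A function $g:\mathcal{H}\to\mathbb{R}$ is locally Lipschitz near $x$ if there are $\varepsilon>0$ and $L>0$ with $|g(y)-g(z)|\le L\|y-z\|$ for all $y,z$ in the open ball $B_\varepsilon(x)$. The generalized directional derivative is $g^\circ(x;v)=\limsup_{y\to x,\,t\searrow 0}\frac{g(y+tv)-g(y)}{t}$ (an extended real number in general, finite if $g$ is locally Lipschitz near $x$), and the Clarke subdifferential is $\partial g(x)=\{\xi\in\mathcal{H}^*: g^\circ(x;v)\ge\xi(v)\ \text{for all } v\in\mathcal{H}\}$. For $\varepsilon\ge0$ the (Goldstein) $\varepsilon$-subdifferential is $\partial_\varepsilon g(x)=\overline{\operatorname{conv}}\big(\bigcup_{y\in\overline{B_\varepsilon(x)}}\partial g(y)\big)$, where $\overline{B_\varepsilon(x)}=\{y:\|x-y\|\le\varepsilon\}$,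 $\operatorname{conv}$ is the convex hull and $\overline{\operatorname{conv}}$ is its closure. For $f=(f_1,\dots,f_k)$, $F_\varepsilon(x)=\overline{\operatorname{conv}}\big(\bigcup_{i=1}^k\partial_\varepsilon f_i(x)\big)$. *)

(* Defs.v *)
From HB Require Import structures.
From mathcomp Require Import all_boot all_order all_algebra.
From mathcomp Require Import all_classical all_reals all_analysis.
Set Implicit Arguments.
Unset Strict Implicit.
Unset Printing Implicit Defensive.
Import Order.TTheory GRing.Theory Num.Theory.
Import numFieldNormedType.Exports.

Local Open Scope classical_set_scope.
Local Open Scope ring_scope.

Section dual_space.
Context {R : realType} (V : normedModType R).

Definition dual_pred : {pred (V -> R^o)} :=
  [pred f : V -> R^o | `[< linear f /\ continuous f >]].

Lemma dual_submod_closed : submod_closed dual_pred.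
Proof.
split=> [|a f g].
  apply/asboolP; split=> [b u v|x]; first by rewrite /= scaler0 addr0.
  exact: (@cst_continuous V R^o 0).
move=> /asboolP[lf cf] /asboolP[lg cg]; apply/asboolP; split=> [b u v|x].
  rewrite !fctE lf lg !scalerDr !scalerA (mulrC a b) -!addrA; congr (_ + _).
  by rewrite addrCA.
by apply: cvgD; [apply: cvgZr; exact: cf | exact: cg].
Qed.

HB.instance Definition _ :=
  GRing.isSubmodClosed.Build R (V -> R^o) dual_pred dual_submod_closed.

Record dual := Dual { dual_fun :> V -> R^o; dualP : dual_fun \in dual_pred }.

HB.instance Definition _ := [isSub for dual_fun].
HB.instance Definition _ := [Choice of dual by <:].
HB.instance Definition _ := [SubChoice_isSubLmodule of dual by <:].

Lemma dual_linear (f : dual) : linear f.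
Proof. by have /asboolP[] := dualP f. Qed.

Lemma dual_continuous (f : dual) : continuous f.
Proof. by have /asboolP[] := dualP f. Qed.

HB.instance Definition _ (f : dual) :=
  GRing.isLinear.Build R V R^o *:%R (dual_fun f) (@dual_linear f).

Definition dual_norm (f : dual) : R :=
  sup [set `|f v| | v in [set v : V | `|v| <= 1]].

Let unit_values (f : dual) := [set `|f v| | v in [set v : V | `|v| <= 1]].

Let unit_values_has_sup f : has_sup (unit_values f).
Proof.
split; first by exists `|f 0|, 0 => //=; rewrite normr0.
have /linear_bounded_continuous/bounded_funP/(_ 1)[M fM] := @dual_continuous f.
by exists M => _ [v v1 <-]; exact: fM.
Qed.

Lemma dual_norm_ge (f : dual) (v : V) : `|v| <= 1 -> `|f v| <= dual_norm f.
Proof.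
by move=> v1; apply: (ub_le_sup (proj2 (unit_values_has_sup f))); exists v.
Qed.

Lemma dual_norm_le (f : dual) (M : R) :
  (forall v, `|v| <= 1 -> `|f v| <= M) -> dual_norm f <= M.
Proof.
move=> fM; apply: ge_sup; first exact: (proj1 (unit_values_has_sup f)).
by move=> _ [v v1 <-]; exact: fM.
Qed.

Lemma dual_norm_ge0 (f : dual) : 0 <= dual_norm f.
Proof.
by apply: le_trans (@dual_norm_ge f 0 _); rewrite ?normr_ge0// normr0.
Qed.

Let ler_dual_normD (f g : dual) :
  dual_norm (f + g) <= dual_norm f + dual_norm g.
Proof.
apply: dual_norm_le => v v1; apply: (le_trans (ler_normD (f v) (g v))).
by apply: lerD; exact: dual_norm_ge.
Qed.

Let dual_normZ_le (a : R) (f : dual) : dual_norm (a *: f) <= `|a| * dual_norm f.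
Proof.
apply: dual_norm_le => v v1; rewrite (normrM a (f v)).
by rewrite ler_wpM2l//; exact: dual_norm_ge.
Qed.

Let dual_normZ (a : R) (f : dual) : dual_norm (a *: f) = `|a| * dual_norm f.
Proof.
apply/eqP; rewrite eq_le dual_normZ_le/=.
have [->|a0] := eqVneq a 0; first by rewrite normr0 mul0r dual_norm_ge0.
rewrite -ler_pdivlMl ?normr_gt0// -normfV.
by have := dual_normZ_le a^-1 (a *: f); rewrite scalerA mulVf// scale1r.
Qed.

Let dual_norm_eq0 (f : dual) : dual_norm f = 0 -> f = 0.
Proof.
move=> f0; apply/val_inj/funext => v /=.
have [->|v0] := eqVneq v 0; first by rewrite raddf0.
have := @dual_norm_ge f (`|v|^-1 *: v) _.
rewrite f0 linearZ/= normrZ normfV normr_id mulVf ?normr_eq0// => /(_ (lexx _)).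
rewrite (normrM `|v|^-1 (f v)) pmulr_rle0; last first.
  by rewrite normr_gt0 invr_eq0 normr_eq0.
by rewrite normr_le0 => /eqP.
Qed.

HB.instance Definition _ :=
  Lmodule_isNormed.Build R dual ler_dual_normD dual_normZ dual_norm_eq0.

End dual_space.

Definition weak_cvg {R : realType} {V : normedModType R}
    (u : nat -> V) (l : V) : Prop :=
  forall phi : dual V, phi (u n) @[n --> \oo] --> phi l.

(* The two arguments of convex_set make the ambient type the alias
   convex_lmodType V of V. *)
Definition convex_hull {R : realType} {V : normedModType R} (A : set V) : set V :=
  smallest (@convex_set R V) A.

Definition closed_convex_hull {R : realType} {V : normedModType R} (A : set V) :
    set V :=
  closure (convex_hull A).

Section clarke.
Context {R : realType} {V : normedModType R}.
Implicit Types (g : V -> R) (x v : V).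

Definition locally_lipschitz g x : Prop :=
  exists e L : R, [/\ 0 < e, 0 < L &
    forall y z, ball x e y -> ball x e z -> `|g y - g z| <= L * `|y - z|].

Definition clarke_dd g x v : \bar R :=
  limf_esup
    (fun p : V * R => ((g (p.1 + p.2 *: v) - g p.1) / p.2)%:E)
    (filter_prod (nbhs x) (0 : R)^'+).

Definition clarke_subdiff g x : set (dual V) :=
  [set xi | forall v, ((xi v)%:E <= clarke_dd g x v)%E].

(* closed_ball_ is the ball `|x - y| <= e; the library's closed_ball, being the
   closure of the open ball, is empty for e = 0. *)
Definition goldstein_subdiff (e : R) g x : set (dual V) :=
  closed_convex_hull (\bigcup_(y in closed_ball_ Num.norm x e) clarke_subdiff g y).

Definition goldstein_family k (f : 'I_k -> V -> R) (e : R) x : set (dual V) :=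
  closed_convex_hull (\bigcup_i goldstein_subdiff e (f i) x).

End clarke.

(* Main.v *)
Require Import Defs.
From HB Require Import structures.
From mathcomp Require Import all_boot all_order all_algebra.
From mathcomp Require Import all_classical all_reals all_analysis.
From mathcomp Require Import ring lra.
Import Order.TTheory GRing.Theory Num.Theory.
Import numFieldNormedType.Exports.

Local Open Scope classical_set_scope.
Local Open Scope ring_scope.

(** Write [p_i] for the generalized directional derivative of [f i] at [x]. As
    [f i] is Lipschitz near [x], [p_i] is a finite sublinear function bounded by
    a multiple of the norm ([sublinear_clarke_dd]), and the Clarke
    subdifferential of [f i] at [x] is the set of functionals below [p_i].

    The whole statement rests on one description of the convex hull of these
    subdifferentials: a functional [xi] belongs to it as soon as [xi v] is at
    most the maximum of the [p_i v], for every [v] ([mem_convex_hull_clarke]).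
    So the hull is cut out by inequalities tested at one vector at a time, and
    these pass to weak limits and to closures. Given [v] and a number [c] above
    all the [p_i v], upper semicontinuity of the directional derivative in the
    base point ([clarke_dd_usc]) bounds it by [c] at all points near [x] in the
    direction [v]; hence [eta v <= c] for each [eta] in [F_eps(y)], if [y] is
    close to [x] and [eps] is small, because a half-space is closed and convex.
    This gives [xi v <= c] in the limit ([goldstein_family_limit]). The equality
    between [F_0(x)] and the convex hull without closures is the case of constant
    sequences.

    The description of the hull is a splitting of functionals: if [xi] is
    dominated by the maximum of [p_1, ..., p_k], then [xi] is a sum of functionals
    [phi_i <= l_i p_i], with nonnegative weights [l_i] of sum [1]
    ([le_max_sublinear_split]). Dividing [phi_i] by [l_i] exhibits [xi] as a convex
    combination of subgradients. The [phi_i] and the [l_i] are found together, by a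
    single use of the Mazur-Orlicz form of the Hahn-Banach theorem
    ([mazur_orlicz]) on a space of families of pairs made of a vector and a
    scalar. That theorem is obtained from the Zorn lemma: a minimal sublinear
    function is linear. *)

(** * Sublinear functions and the Hahn-Banach theorem *)

Section sublinear.
Set Implicit Arguments.
Unset Strict Implicit.
Context {R : realType} {E : lmodType R}.
Implicit Types (p q : E -> R) (u v w h : E).

Definition sublinear q : Prop :=
  (forall u v, q (u + v) <= q u + q v) /\
  (forall (c : R) u, 0 <= c -> q (c *: u) = c * q u).

Lemma sublinear0 q : sublinear q -> q 0 = 0.
Proof. by case=> _ qZ; rewrite -(scale0r 0) qZ// mul0r. Qed.

Lemma sublinear_geN q v : sublinear q -> - q (- v) <= q v.
Proof.
move=> sq; rewrite -subr_ge0 opprK -(sublinear0 sq) -[X in q X](subrr v).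
by case: sq => qD _; exact: qD.
Qed.

(** Applying the third hypothesis to the inverse scalar gives equality in it; at
    the vector [0] and the scalar [1/2] it gives [q 0 <= 0]. *)
Lemma sublinear_of_le q : 0 <= q 0 ->
  (forall u v, q (u + v) <= q u + q v) ->
  (forall (c : R) u, 0 < c -> q (c *: u) <= c * q u) -> sublinear q.
Proof.
move=> q0 qD qZ; split=> // c u; rewrite le_eqVlt => /predU1P[<-|c0].
  rewrite scale0r mul0r; have /(_ 2^-1 0) := qZ.
  by rewrite scaler0 invr_gt0 ltr0n => /(_ isT) ?; lra.
apply/eqP; rewrite eq_le qZ//= -ler_pdivlMl//.
by have := qZ c^-1 (c *: u); rewrite scalerA mulVf ?gt_eqF// scale1r invr_gt0; exact.
Qed.

(** A pointwise infimum is sublinear as soon as the sets of values are downward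
    compatible with sums and dilations. Each [S v] is then bounded below by the
    opposite of any element of [S (- v)], as a sum of the two lies above an
    element of [S 0]. This serves both for the infimum of a chain and for the
    infimum of [q] along a cone. *)
Lemma sublinear_inf (S : E -> set R) :
  (forall v, S v !=set0) ->
  (forall a, S 0 a -> 0 <= a) ->
  (forall u v a b, S u a -> S v b -> exists2 c, S (u + v) c & c <= a + b) ->
  (forall (t : R) u a, 0 < t -> S u a -> exists2 b, S (t *: u) b & b <= t * a) ->
  sublinear (fun v => inf (S v)) /\ forall v a, S v a -> inf (S v) <= a.
Proof.
move=> Sne S0 SD SZ.
have infS v a : S v a -> inf (S v) <= a.
  have [b Sb] := Sne (- v); apply: ge_inf; exists (- b) => c Sc.
  have [d] := SD _ _ _ _ Sc Sb; rewrite subrr => /S0; lra.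
split=> //; apply: sublinear_of_le.
- exact: lb_le_inf.
- move=> u v /=; rewrite -lerBlDr; apply: lb_le_inf => // a Sa.
  rewrite lerBlDr -lerBlDl; apply: lb_le_inf => // b Sb.
  have [c Sc cab] := SD _ _ _ _ Sa Sb.
  by rewrite lerBlDl; apply: (le_trans (infS _ _ Sc)).
- move=> t u t0 /=; rewrite -ler_pdivrMl//; apply: lb_le_inf => // a Sa.
  have [b Sb ba] := SZ _ _ _ t0 Sa.
  by rewrite ler_pdivrMl//; apply: (le_trans (infS _ _ Sb)).
Qed.

(** [K] is a convex cone of pairs [(h, b)], and [q'] is the infimum over [K] of
    [q (v + h) + b]. A linear function below [q'] is at most [b] at [- h], that
    is, it satisfies the constraints [- b <= phi h] encoded by [K]. *)
Lemma sublinear_cone q (K : E -> R -> Prop) : sublinear q -> K 0 0 ->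
  (forall h b h' b', K h b -> K h' b' -> K (h + h') (b + b')) ->
  (forall (t : R) h b, 0 < t -> K h b -> K (t *: h) (t * b)) ->
  (forall h b, K h b -> 0 <= q h + b) ->
  exists2 q', sublinear q' & forall v h b, K h b -> q' v <= q (v + h) + b.
Proof.
move=> [qD qZ] K0 KD KZ Kq.
pose S v := [set a | exists h b, K h b /\ a = q (v + h) + b].
have [||||sS Sle] := @sublinear_inf S.
- by move=> v; exists (q (v + 0) + 0), 0, 0.
- by move=> _ [h [b [Khb ->]]]; rewrite add0r Kq.
- move=> u v _ _ [h [b [Khb ->]]] [h' [b' [Khb' ->]]].
  exists (q (u + v + (h + h')) + (b + b')).
    by do 2!eexists; split; first exact: KD Khb Khb'.
  by rewrite addrACA [X in _ <= X]addrACA lerD2r qD.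
- move=> t u _ t0 [h [b [Khb ->]]]; exists (q (t *: u + t *: h) + t * b).
    by do 2!eexists; split; first exact: KZ t0 Khb.
  by rewrite -scalerDr (qZ _ _ (ltW t0)) mulrDr.
by exists (fun v => inf (S v)) => // v h b Khb; apply: Sle; exists h, b.
Qed.

Lemma exists_minimal_sublinear p : sublinear p ->
  exists q, [/\ sublinear q, forall v, q v <= p v &
    forall q', sublinear q' -> (forall v, q' v <= q v) -> q' = q].
Proof.
move=> sp; pose T := {q | sublinear q /\ forall v, q v <= p v}.
(* [D] reverses the pointwise order: its maximal elements are the minimal functions. *)
pose D (s t : T) := `[< forall v, sval t v <= sval s v >].
have [|||A totA|[q [sq qp]] qmin] := @Zorn T D.
- by move=> t; apply/asboolP.
- by move=> r s t /asboolP rs /asboolP st; apply/asboolP => v; exact: le_trans (rs v).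
- move=> [s Ps] [t Pt] /asboolP /= st /asboolP/= ts; apply: eq_exist.
  by apply/funext => v; apply/eqP; rewrite eq_le ts st.
- have [[q0 Aq0]|A0] := pselect (exists t, A t); last first.
    by exists (exist _ p (conj sp (fun=> lexx _))) => s As; case: A0; exists s.
  pose S v := [set a | exists2 t, A t & a = sval t v].
  have [||||sS Sle] := @sublinear_inf S.
  + by move=> v; exists (sval q0 v), q0.
  + by move=> _ [[t [st tp]] _ ->] /=; rewrite sublinear0.
  + move=> u v _ _ [s As ->] [t At ->].
    have [r [Ar rs rt]] : exists r, [/\ A r, forall v, sval r v <= sval s v &
        forall v, sval r v <= sval t v].
      by have [/asboolP|/asboolP] := totA _ _ As At; [exists t|exists s].
    exists (sval r (u + v)); first by exists r.
    by case: r Ar rs rt => r [[rD _] _] /= _ rs rt; rewrite (le_trans (rD u v))// lerD.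
  + move=> t u _ t0 [s As ->]; exists (sval s (t *: u)); first by exists s.
    by case: s As => s [[_ sZ] _] /= _; rewrite sZ// ltW.
  have Sp v : inf (S v) <= p v.
    by apply: (@le_trans _ _ (sval q0 v)); [apply: Sle; exists q0|case: q0 {Aq0} => ? []].
  have sSp : sublinear (fun v => inf (S v)) /\ forall v, inf (S v) <= p v by [].
  exists (exist _ (fun v => inf (S v)) sSp) => s As; apply/asboolP => v /=.
  by apply: Sle; exists s.
exists q; split=> // q' sq' q'q.
have q'p v : q' v <= p v by exact: le_trans (qp v).
have sqp' : sublinear q' /\ forall v, q' v <= p v by [].
by have /(congr1 sval) := qmin (exist _ q' sqp') (asboolT q'q).
Qed.

(** A minimal sublinear function [q] is odd, hence linear: the infimum of
    [q (v + t w) - t q w] over [t >= 0] is sublinear and below [q], so it is [q],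
    and its term [t = 1] at [v = - w] is [- q w]. *)
Lemma exists_linear_le p : sublinear p ->
  exists phi : {linear E -> R^o}, forall v, phi v <= p v.
Proof.
move=> /exists_minimal_sublinear[q [sq qp qmin]].
have [qD qZ] := sq.
have qN w : q (- w) = - q w.
  pose K h (b : R) := exists2 t, 0 <= t & h = t *: w /\ b = - (t * q w).
  have [||||q' sq' q'K] := @sublinear_cone q K sq.
  - by exists 0 => //; rewrite scale0r mul0r oppr0.
  - move=> _ _ _ _ [s s0 [-> ->]] [t t0 [-> ->]].
    by exists (s + t); rewrite ?addr_ge0// scalerDl mulrDl opprD.
  - move=> s _ _ s0 [t t0 [-> ->]].
    by exists (s * t); rewrite ?mulr_ge0// ?ltW// scalerA mulrN mulrA.
  - by move=> _ _ [t t0 [-> ->]]; rewrite qZ// subrr.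
  have q'q : q' = q.
    apply: qmin => // v; have := q'K v 0 0; rewrite !addr0; apply.
    by exists 0 => //; rewrite scale0r mul0r oppr0.
  apply/eqP; rewrite eq_le; apply/andP; split; last first.
    by have := sublinear_geN (- w) sq; rewrite opprK.
  have := q'K (- w) w (- q w); rewrite q'q addNr (sublinear0 sq) add0r; apply.
  by exists 1; rewrite ?scale1r ?mul1r.
have qadd u v : q (u + v) = q u + q v.
  apply/eqP; rewrite eq_le qD /= -lerBrDr -qN.
  by rewrite (le_trans _ (qD _ _))// addrK.
have qlin : linear (q : E -> R^o).
  move=> c u v; rewrite qadd; congr (_ + _).
  have [c0|c0] := leP 0 c; first exact: qZ.
  by rewrite -[c]opprK scaleNr qN qZ ?oppr_ge0 ?ltW// scaleNr.
pose phi := HB.pack_for {linear E -> R^o} (q : E -> R^o)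
  (GRing.isLinear.Build R E R^o *:%R q qlin).
by exists phi.
Qed.

(** The Mazur-Orlicz theorem; the Hahn-Banach extension theorem is the case where
    [K] is, up to sign, the graph of a linear function on a subspace. *)
Lemma mazur_orlicz q (K : E -> R -> Prop) : sublinear q -> K 0 0 ->
  (forall h b h' b', K h b -> K h' b' -> K (h + h') (b + b')) ->
  (forall (t : R) h b, 0 < t -> K h b -> K (t *: h) (t * b)) ->
  (forall h b, K h b -> 0 <= q h + b) ->
  exists2 phi : {linear E -> R^o}, forall v, phi v <= q v &
    forall h b, K h b -> - b <= phi h.
Proof.
move=> sq K0 KD KZ Kq.
have [q' /exists_linear_le[phi phiq'] q'K] := sublinear_cone sq K0 KD KZ Kq.
exists phi => [v|h b Khb].
  by rewrite (le_trans (phiq' v))//; have := q'K v _ _ K0; rewrite !addr0.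
have := le_trans (phiq' (- h)) (q'K (- h) _ _ Khb).
by rewrite addNr (sublinear0 sq) add0r linearN lerNl.
Qed.

End sublinear.

(** * Functionals dominated by a maximum of sublinear functions *)

Section max_of_sublinear.
Set Implicit Arguments.
Unset Strict Implicit.
Context {R : realType} {V : lmodType R}.

(** On families [z] of pairs (vector, scalar), [q z] is the maximum of
    [p i (z i).1 + (z i).2]. The hypothesis says that [xi] is below [q] on the
    diagonal vectors [diag d 0]; a linear [Phi <= q] agreeing there with [xi]
    decomposes into the required functionals [phi i] and scalars [l i], its
    components. Its domination by [q] on the scalar part makes [l] a probability
    vector, and at the family whose only nonzero entry is [(v, - p i v)] it gives
    [phi i v <= l i * p i v]. *)
Lemma le_max_sublinear_split n (p : 'I_n.+1 -> V -> R) (xi : {linear V -> R^o}) :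
  (forall i, sublinear (p i)) -> (forall v, exists i, xi v <= p i v) ->
  exists (l : 'I_n.+1 -> R) (phi : 'I_n.+1 -> {linear V -> R^o}),
    [/\ forall i, 0 <= l i, \sum_i l i = 1,
        forall i v, phi i v <= l i * p i v & forall v, xi v = \sum_i phi i v].
Proof.
move=> sp xip.
pose E : lmodType R := ('I_n.+1 -> (V * R^o)%type) : lmodType R.
pose s (z : E) i : R := p i (z i).1 + (z i).2.
pose q (z : E) : R := \big[Num.max/s z ord0]_i s z i.
have q_le z c : (forall i, s z i <= c) -> q z <= c by move=> zc; exact: bigmax_le.
have q_ge z i : s z i <= q z by exact: le_bigmax.
have sq : sublinear q.
  apply: sublinear_of_le.
  - by apply: le_trans (q_ge _ ord0); rewrite -[s 0 _]/(p ord0 0 + 0) sublinear0// addr0.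
  - move=> u v; apply: q_le => i; apply: (le_trans _ (lerD (q_ge u i) (q_ge v i))).
    by rewrite /s /= addrACA lerD2r (sp i).1.
  - move=> c u c0; apply: q_le => i; rewrite -ler_pdivrMl//.
    apply: le_trans (q_ge u i); rewrite ler_pdivrMl//.
    by rewrite /s /= (sp i).2 ?(ltW c0)// mulrDr.
pose diag (d : V) (t : R) : E := fun=> (d, t).
pose K (h : E) (b : R) := exists2 d, h = diag d 0 & b = - xi d.
have [||||Phi Phiq PhiK] := @mazur_orlicz R E q K sq.
- by exists 0; rewrite ?linear0 ?oppr0.
- move=> _ _ _ _ [d -> ->] [d' -> ->]; exists (d + d'); last by rewrite linearD opprD.
  by apply/funext => i; rewrite /diag/= -[RHS]/(d + d', 0) -[in RHS](addr0 0).
- move=> t _ _ t0 [d -> ->]; exists (t *: d); last by rewrite linearZ/= mulrN.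
  by apply/funext => i; rewrite /diag/= -[in RHS](scaler0 _ t).
- move=> _ _ [d -> ->]; have [i xii] := xip d.
  by rewrite subr_ge0 (le_trans xii)// (le_trans _ (q_ge _ i))// /s /= addr0.
pose inj i (v : V) (t : R) : E := fun j => if j == i then (v, t) else 0.
have injP c i u v a b : inj i (c *: u + v) (c * a + b) = c *: inj i u a + inj i v b.
  apply/funext => j; rewrite /inj -[RHS]/(c *: inj i u a j + inj i v b j) /inj.
  by case: eqP => // _; rewrite scaler0 addr0.
have inj_sum z : z = \sum_i inj i (z i).1 (z i).2.
  apply/funext => j; rewrite fct_sumE (bigD1 j)//= big1 ?addr0 /inj ?eqxx//.
    by case: (z j).
  by move=> i ij; rewrite eq_sym (negbTE ij).
have phi_lin i : linear ((fun v => Phi (inj i v 0)) : V -> R^o).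
  move=> c u v.
  by rewrite -[X in inj i _ X](addr0 0) -[X in X + 0](mulr0 c) injP linearP.
pose phi i := HB.pack_for {linear V -> R^o} ((fun v => Phi (inj i v 0)) : V -> R^o)
  (GRing.isLinear.Build R V R^o *:%R _ (phi_lin i)).
pose l i : R := Phi (inj i 0 1).
have Phi_inj i v t : Phi (inj i v t) = phi i v + t * l i.
  rewrite addrC -[phi i v]/(Phi (inj i v 0)) -[t * _]/(t *: Phi (inj i 0 1)).
  rewrite -linearP -injP.
  by rewrite scaler0 add0r mulr1 addr0.
have Phi_sum z : Phi z = \sum_i (phi i (z i).1 + (z i).2 * l i).
  by rewrite [in LHS](inj_sum z) linear_sum; apply: eq_bigr => i _; rewrite Phi_inj.
have Phi_diag d t : Phi (diag d t) = \sum_i phi i d + t * \sum_i l i.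
  by rewrite Phi_sum big_split/= mulr_sumr.
have s_inj i v t j : s (inj i v t) j = if j == i then p i v + t else 0.
  rewrite /s /inj; case: eqP => [->//|_].
  by rewrite -[X in X = _]/(p j 0 + 0) sublinear0// addr0.
have sum_t t : t * \sum_i l i <= t.
  have -> : t * \sum_i l i = Phi (diag 0 t).
    by rewrite Phi_diag [X in _ = X + _]big1 ?add0r// => i _; rewrite linear0.
  by apply: (le_trans (Phiq _)); apply: q_le => i; rewrite /s /= sublinear0// add0r.
exists l, phi; split.
- move=> i; have := Phiq (inj i 0 (-1)); rewrite Phi_inj linear0 add0r mulN1r.
  move=> /le_trans/(_ (q_le _ 0 _)); rewrite oppr_le0; apply => j.
  by rewrite s_inj; case: eqP => // _; rewrite sublinear0// add0r oppr_le0.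
- apply/eqP; rewrite eq_le -[X in X <= 1]mul1r sum_t/= -lerN2 -mulN1r.
  exact: sum_t.
- move=> i v; rewrite -subr_le0 -mulNr mulrC mulrN -mulNr -Phi_inj.
  apply: (le_trans (Phiq _)); apply: q_le => j; rewrite s_inj.
  by case: eqP => // _; rewrite subrr.
- have xi_le d : xi d <= \sum_i phi i d.
    have := PhiK (diag d 0) (- xi d); rewrite opprK Phi_diag mul0r addr0; apply.
    by exists d.
  move=> v; apply/eqP; rewrite eq_le xi_le/= -lerN2 -linearN.
  apply: (le_trans (xi_le (- v))); rewrite -sumrN; apply: ler_sum => i _.
  by rewrite linearN.
Qed.

End max_of_sublinear.

(** * The generalized directional derivative *)

Section clarke_derivative.
Set Implicit Arguments.
Unset Strict Implicit.
Context {R : realType} {V : normedModType R}.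
Implicit Types (g : V -> R) (x y v : V) (c e d t : R).

Lemma clarke_dd_lt g x v c : (clarke_dd g x v < c%:E)%E ->
  exists2 e, 0 < e & forall y t, ball x e y -> 0 < t < e ->
    g (y + t *: v) - g y < c * t.
Proof.
move=> /ereal_inf_lt[_ [A [[P Q] /= [xP Q0] PQA] <-]] Ac.
have /nbhs_ballP[e1 /= e10 e1P] := xP.
have /nbhs_ballP[e2 /= e20 e2Q] := Q0.
exists (Num.min e1 e2); first by rewrite lt_min e10.
move=> y t xy /andP[t0]; rewrite lt_min => /andP[_ te2].
rewrite -ltr_pdivrMr// -lte_fin (le_lt_trans _ Ac)//.
apply: ereal_sup_ubound; exists (y, t) => //; apply: PQA; split=> /=.
  by apply/e1P/(le_ball _ xy); rewrite ge_min lexx.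
by apply: e2Q => //; rewrite -ball_normE /= sub0r normrN gtr0_norm.
Qed.

Lemma clarke_dd_le g x v c e : 0 < e ->
  (forall y t, ball x e y -> 0 < t < e -> g (y + t *: v) - g y <= c * t) ->
  (clarke_dd g x v <= c%:E)%E.
Proof.
move=> e0 gc; apply: ge_ereal_inf.
exists (ereal_sup ((fun p : V * R => ((g (p.1 + p.2 *: v) - g p.1) / p.2)%:E) @`
  (ball x e `*` [set t | 0 < t < e]))).
  exists (ball x e `*` [set t | 0 < t < e]) => //.
  exists (ball x e, [set t | 0 < t < e]) => //=; split; first exact: nbhsx_ballx.
  apply/nbhs_ballP; exists e => // t; rewrite -ball_normE /= sub0r normrN => te t0.
  by rewrite t0 -[t]gtr0_norm.
apply: ge_ereal_sup => _ [[y t] /= [xy /[dup] t0e /andP[t0 _]] <-].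
by rewrite lee_fin ler_pdivrMr// gc.
Qed.

(** The difference quotients involved at a point [y] close to [x] are among those
    involved at [x]. *)
Lemma clarke_dd_usc g x v c : (clarke_dd g x v < c%:E)%E ->
  \forall y \near x, (clarke_dd g y v <= c%:E)%E.
Proof.
move=> /clarke_dd_lt[e e0 gc]; apply/nbhs_ballP.
exists (e / 2); first by rewrite /= divr_gt0.
move=> y xy; apply: (@clarke_dd_le _ _ _ _ (e / 2)); first by rewrite divr_gt0.
move=> z t yz /andP[t0 te]; apply/ltW/gc.
  by rewrite (splitr e); exact: ball_triangle yz.
by rewrite t0 (lt_trans te)// ltr_pdivrMr// ltr_pMr// ltr1n.
Qed.

(** Moving the base point by [t v] with [t] small stays near [x]; this is what
    makes the directional derivative subadditive in the direction. *)
Lemma ball_step x v e : 0 < e -> exists2 d, 0 < d <= e &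
  forall y t, ball x d y -> 0 < t < d -> ball x e (y + t *: v).
Proof.
move=> e0; have v0 : 0 < 1 + `|v| by rewrite ltr_pwDl.
have e20 : 0 < e / (2 * (1 + `|v|)) by rewrite divr_gt0// mulr_gt0.
have ed : e / (2 * (1 + `|v|)) * (1 + `|v|) = e / 2 by field; rewrite gt_eqF.
exists (e / (2 * (1 + `|v|))).
  rewrite e20/= ler_pdivrMr ?mulr_gt0// ler_pMr//.
  by have := normr_ge0 v; lra.
move=> y t; rewrite -!ball_normE /ball_/= => xy /andP[t0 te].
rewrite opprD addrA (le_lt_trans (ler_normB _ _))// normrZ gtr0_norm//.
have tv : t * `|v| <= e / (2 * (1 + `|v|)) * `|v| by rewrite ler_wpM2r// ltW.
apply: (lt_le_trans (ltr_leD xy tv)).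
by rewrite -[X in X + _]mulr1 -mulrDr ed ler_pdivrMr// ler_pMr// ler1n.
Qed.

Lemma locally_lipschitz_clarke_dd g x : locally_lipschitz g x ->
  exists2 L, 0 < L & forall v,
    ((- (L * `|v|))%:E <= clarke_dd g x v <= (L * `|v|)%:E)%E.
Proof.
move=> [e [L [e0 L0 gL]]]; exists L => // v.
have [d /andP[d0 de] xd] := ball_step x v e0.
have gv y t : ball x d y -> 0 < t < d -> `|g (y + t *: v) - g y| <= L * `|v| * t.
  move=> xy td; have xyt := xd _ _ xy td.
  have := gL _ _ xyt (le_ball de xy); rewrite [_ + _ - y]addrC addKr normrZ.
  by case/andP: td => t0 _; rewrite (gtr0_norm t0) (mulrC t) mulrA.
apply/andP; split; last first.
  by apply: (clarke_dd_le d0) => y t xy td; exact: le_trans (ler_norm _) (gv _ _ xy td).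
rewrite leNgt; apply/negP => /clarke_dd_lt[e1 e10 ge1].
pose t := Num.min d e1 / 2.
have m0 : 0 < Num.min d e1 by rewrite lt_min d0.
have tm : t < Num.min d e1 by rewrite /t; lra.
move: (tm); rewrite lt_min => /andP[td te].
have t0 : 0 < t by rewrite divr_gt0.
have := ge1 x t (ballxx x e10); rewrite t0 te => /(_ isT).
have := gv x t (ballxx x d0); rewrite t0 td => /(_ isT).
by rewrite ler_norml mulNr => /andP[+ _]; lra.
Qed.

Lemma sublinear_clarke_dd g x : locally_lipschitz g x ->
  exists p : V -> R, [/\ sublinear p, forall v, clarke_dd g x v = (p v)%:E &
    exists L, forall v, p v <= L * `|v|].
Proof.
move=> /locally_lipschitz_clarke_dd[L L0 ddL].
pose p v := fine (clarke_dd g x v).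
have ddE v : clarke_dd g x v = (p v)%:E.
  rewrite fineK// fin_numE; have /andP[] := ddL v.
  by case: (clarke_dd g x v).
have p_ltP v c : p v < c -> exists2 e, 0 < e & forall y t, ball x e y -> 0 < t < e ->
    g (y + t *: v) - g y < c * t.
  by move=> pvc; apply: clarke_dd_lt; rewrite ddE lte_fin.
have p_le v c e : 0 < e ->
  (forall y t, ball x e y -> 0 < t < e -> g (y + t *: v) - g y <= c * t) -> p v <= c.
  by move=> e0 gc; rewrite -lee_fin -ddE; exact: clarke_dd_le gc.
exists p; split=> //; last by exists L => v; have /andP[_] := ddL v; rewrite ddE lee_fin.
apply: sublinear_of_le.
- by have /andP[] := ddL 0; rewrite normr0 mulr0 oppr0 ddE lee_fin.
- move=> u v; apply/ler_addgt0Pr => a a0.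
  have [|e1 e10 gu] := p_ltP u (p u + a / 2); first by lra.
  have [|e2 e20 gv] := p_ltP v (p v + a / 2); first by lra.
  have [d /andP[d0 de2] xd] := ball_step x u e20.
  (* The increment along [u + v] is the increment along [u] from [y] plus the
     increment along [v] from the shifted point [y + t u]. *)
  apply: (@p_le _ _ (Num.min e1 d)); first by rewrite lt_min e10.
  move=> y t; set m := Num.min _ _ => xy /andP[t0 tm].
  have [te1 td] : t < e1 /\ t < d by move: tm; rewrite lt_min => /andP.
  have xy1 : ball x e1 y by apply: le_ball xy; rewrite ge_min lexx.
  have xyd : ball x d y by apply: le_ball xy; rewrite ge_min lexx orbT.
  have := gu y t xy1; rewrite t0 te1 => /(_ isT).
  have := gv _ t (xd _ t xyd _); rewrite t0 td => /(_ isT).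
  by rewrite (lt_le_trans td)// scalerDr addrA => /(_ isT); lra.
- move=> c v c0; apply/ler_addgt0Pr => a a0.
  have [|e e0 gv] := p_ltP v (p v + a / c); first by rewrite ltrDl divr_gt0.
  apply: (@p_le _ _ (Num.min e (e / c))); first by rewrite lt_min e0 divr_gt0.
  move=> y t xy /andP[t0]; rewrite lt_min ltr_pdivlMr// => /andP[te tce].
  have xye : ball x e y by apply: le_ball xy; rewrite ge_min lexx.
  have := gv y (t * c) xye; rewrite mulr_gt0// tce => /(_ isT); rewrite scalerA.
  rewrite (_ : (p v + a / c) * (t * c) = (c * p v + a) * t) => [/ltW//|].
  by field; rewrite gt_eqF.
Qed.

End clarke_derivative.

(** * Continuous functionals, half-spaces and convex combinations *)

Section functional_of_bound.
Set Implicit Arguments.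
Unset Strict Implicit.
Context {R : realType} {V : normedModType R}.

Lemma linear_le_dual (phi : {linear V -> R^o}) (M : R) :
  (forall v, phi v <= M * `|v|) -> exists eta : dual V, forall v, eta v = phi v.
Proof.
move=> phiM.
have phi_norm v : `|phi v| <= M * `|v|.
  by rewrite ler_norml phiM lerNl -linearN -(normrN v) phiM.
have phi_cont : continuous phi.
  apply/bounded_linear_continuous/linear_boundedP.
  exists M; split=> [|r /ltW Mr v]; first exact: num_real.
  by apply: (le_trans (phi_norm v)); rewrite ler_wpM2r.
have phiP : (phi : V -> R^o) \in @dual_pred R V.
  by apply/asboolP; split=> //; exact: linearP.
by exists (Dual phiP).
Qed.

End functional_of_bound.

Section dual_evaluation.
Set Implicit Arguments.
Unset Strict Implicit.
Context {R : realType} {V : normedModType R}.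

Lemma dual_norm_bound (eta : dual V) v : eta v <= `|v| * `|eta|.
Proof.
have [->|v0] := eqVneq v 0; first by rewrite linear0 normr0 mul0r.
have nv0 : 0 < `|v| by rewrite normr_gt0.
have := @dual_norm_ge R V eta (`|v|^-1 *: v).
rewrite normrZ normfV normr_id mulVf ?gt_eqF// => /(_ (lexx _)).
by move=> /(le_trans (ler_norm _)); rewrite linearZ ler_pdivrMl.
Qed.

(** Evaluation at a vector belongs to the bidual, so weak convergence in the dual
    implies pointwise convergence. *)
Lemma exists_dual_eval (v : V) :
  exists phi : dual (dual V), forall eta : dual V, phi eta = eta v.
Proof.
have lin_eval : linear ((fun eta => eta v) : dual V -> R^o) by [].
pose ev := HB.pack_for {linear dual V -> R^o} ((fun eta => eta v) : dual V -> R^o)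
  (GRing.isLinear.Build R (dual V) R^o *:%R _ lin_eval).
have [|phi phiE] := @linear_le_dual R (dual V) ev `|v|.
  by move=> eta; exact: dual_norm_bound.
by exists phi.
Qed.

Lemma continuous_dual_eval (v : V) : continuous (fun eta : dual V => eta v : R^o).
Proof.
have [phi phiE] := exists_dual_eval v.
by rewrite (_ : (fun _ => _) = phi)//; [exact: dual_continuous|exact/esym/funext].
Qed.

(** The half-space of the functionals with value at most [c] at [v] is convex,
    and closed because the evaluation at [v] is continuous. *)
Lemma closed_convex_hull_le (A : set (dual V)) v (c : R) :
  (forall eta, A eta -> eta v <= c) ->
  forall eta, closed_convex_hull A eta -> eta v <= c.
Proof.
move=> Ac.
pose B := [set eta : dual V | eta v <= c].
have clB : closed B.
  apply: (@preimage_closed _ R (fun eta : dual V => eta v) [set r | r <= c]).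
    by move=> eta _; exact: continuous_dual_eval.
  exact: closed_le.
have hullB : convex_hull A `<=` B.
  apply: smallest_sub => // a b l; rewrite !inE /B /= => av bv.
  rewrite -[X in X <= _]/(l%:num * a v + (1 - l%:num) * b v).
  have l0 : 0 <= l%:num by [].
  have l1 : l%:num <= 1 by [].
  by nra.
by move=> eta /(closureS hullB); rewrite -(closure_id B).1.
Qed.

End dual_evaluation.

Section convex_sum.
Set Implicit Arguments.
Unset Strict Implicit.
Context {R : realType} {M : lmodType R}.

(** The summands come with their weights already multiplied in, and a summand of
    weight [0] has to vanish but need not come from a point of [C]. The pairs
    (weight, weighted point) form a cone stable under addition, which avoids
    renormalizing partial sums. *)
Lemma convex_set_sum (C : set (convex_lmodType M)) n (l : 'I_n -> R) (u : 'I_n -> M) :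
  convex_set C ->
  (forall i, (l i = 0 /\ u i = 0) \/ (0 < l i /\ C ((l i)^-1 *: u i))) ->
  \sum_i l i = 1 -> C (\sum_i u i).
Proof.
move=> Cconv lu suml.
pose K (a : R) (w : M) := (a = 0 /\ w = 0) \/ (0 < a /\ C (a^-1 *: w)).
have : K (\sum_i l i) (\sum_i u i).
  apply: (big_ind2 K) => // [|a w b z|i _]; [by left| |exact: lu].
  move=> [[-> ->]|[a0 Ca]] [[-> ->]|[b0 Cb]]; rewrite ?add0r ?addr0.
  - by left.
  - by right.
  - by right.
  - right; split; first exact: addr_gt0.
    have ab0 : 0 < a + b by exact: addr_gt0.
    have t01 : (0 <= a / (a + b) <= 1).
      by rewrite divr_ge0 ?(ltW a0) ?(ltW ab0)//= ler_pdivrMr// mul1r lerDl ltW.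
    have /andP[t0 t1] := t01; pose t : {i01 R} := Itv01 t0 t1.
    have /set_mem := Cconv _ _ t (mem_set Ca) (mem_set Cb).
    rewrite -[X in C X]/(t%:num *: (a^-1 *: w) + (1 - t%:num) *: (b^-1 *: z)) /=.
    rewrite !scalerA scalerDr; congr C; congr (_ *: _ + _ *: _).
      by field; rewrite ?gt_eqF.
    by field; rewrite ?gt_eqF.
by rewrite suml => -[[/eqP]|[_]]; rewrite ?oner_eq0// invr1 scale1r.
Qed.

Lemma convex_hull_convex (V : normedModType R) (A : set V) : convex_set (convex_hull A).
Proof.
move=> a b t /set_mem Aa /set_mem Ab; apply/mem_set => B [Bconv AB].
by apply/set_mem/Bconv; apply/mem_set; [exact: Aa|exact: Ab].
Qed.

End convex_sum.

(** * The convex hull of the subdifferentials and its stability under limits *)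

Section clarke_hull.
Set Implicit Arguments.
Unset Strict Implicit.
Context {R : realType} {V : normedModType R}.

(** The functionals and weights come from [le_max_sublinear_split]. The bound of
    the directional derivatives by a multiple of the norm makes the functionals
    continuous, and a functional of weight [0] is nonpositive, hence zero. *)
Lemma mem_convex_hull_clarke k (f : 'I_k -> V -> R) (x : V) (xi : dual V) :
  (forall i, locally_lipschitz (f i) x) ->
  (forall v, exists i, ((xi v)%:E <= clarke_dd (f i) x v)%E) ->
  convex_hull (\bigcup_i clarke_subdiff (f i) x) xi.
Proof.
case: k f => [|n] f f_lip xi_le; first by have [[]] := xi_le 0.
have /choice[p pP] := fun i => sublinear_clarke_dd (f_lip i).
have p_sub i : sublinear (p i) by have [] := pP i.
have ddE i v : clarke_dd (f i) x v = (p i v)%:E by have [] := pP i.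
have xi_p v : exists i, xi v <= p i v.
  by have [i] := xi_le v; rewrite ddE lee_fin; exists i.
have [l [phi [l0 suml phip xiE]]] := le_max_sublinear_split p_sub xi_p.
have /choice[eta etaE] i : exists eta : dual V, forall v, eta v = phi i v.
  have [_ _ [L pL]] := pP i; apply: (@linear_le_dual _ _ _ (l i * L)) => v.
  by rewrite (le_trans (phip i v))// -mulrA ler_wpM2l.
have -> : xi = \sum_i eta i.
  apply/val_inj/funext => v /=; have [ev evE] := exists_dual_eval v.
  rewrite xiE -evE linear_sum; apply: eq_bigr => i _.
  by rewrite -[RHS]/(ev (eta i)) evE etaE.
apply: convex_set_sum suml; first exact: convex_hull_convex.
move=> i; have := l0 i; rewrite le_eqVlt => /predU1P[li0|li0]; [left|right]; split=> //.
  apply/val_inj/funext => v /=; rewrite etaE -[RHS]/(0 : R).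
  have phi0 w : phi i w <= 0 by have := phip i w; rewrite -li0 mul0r.
  apply/eqP; rewrite eq_le phi0 /=.
  by have := phi0 (- v); rewrite linearN oppr_le0.
apply: sub_gen_smallest; exists i => // v.
by rewrite ddE lee_fin -[X in X <= _]/((l i)^-1 * eta i v) etaE ler_pdivrMl.
Qed.

Lemma goldstein_family_le k (f : 'I_k -> V -> R) (e : R) x v (c : R) :
  (forall i y, closed_ball_ Num.norm x e y -> (clarke_dd (f i) y v <= c%:E)%E) ->
  forall eta, goldstein_family f e x eta -> eta v <= c.
Proof.
move=> fc; apply: closed_convex_hull_le => eta [i _].
apply: closed_convex_hull_le => {}eta [y xy eta_y].
by rewrite -lee_fin (le_trans (eta_y v))// fc.
Qed.

(** If [xi] exceeded all the directional derivatives at some [v], some [c] would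
    lie strictly in between, and semicontinuity would bound [xi_ j v] by [c]
    for all large [j]. The radii may vanish, so that constant sequences are
    covered. *)
Lemma goldstein_family_limit k (f : 'I_k -> V -> R) (x : V)
    (eps : nat -> R) (x_ : nat -> V) (xi_ : nat -> dual V) (xi : dual V) :
  (forall i, locally_lipschitz (f i) x) ->
  eps j @[j --> \oo] --> 0 -> x_ j @[j --> \oo] --> x ->
  (forall v, xi_ j v @[j --> \oo] --> (xi v : R)) ->
  (forall j, goldstein_family f (eps j) (x_ j) (xi_ j)) ->
  convex_hull (\bigcup_i clarke_subdiff (f i) x) xi.
Proof.
move=> f_lip eps0 x_x xi_xi xi_in; apply: mem_convex_hull_clarke => // v.
apply: contrapT => /forallNP dd_lt.
have {}dd_lt i : (clarke_dd (f i) x v < (xi v)%:E)%E by rewrite ltNge; apply/negP/dd_lt.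
have [c c_xi ddc] : exists2 c, c < xi v & forall i, (clarke_dd (f i) x v < c%:E)%E.
  have /choice[p pP] := fun i => sublinear_clarke_dd (f_lip i).
  have ddE i : clarke_dd (f i) x v = (p i v)%:E by have [_ ->] := pP i.
  (* The base value [xi v - 1] keeps the maximum below [xi v] for an empty family. *)
  pose m := \big[Num.max/xi v - 1]_i p i v.
  have m_xi : m < xi v.
    apply: bigmax_lt => [|i _]; first by rewrite ltrBlDr ltrDl.
    by rewrite -lte_fin -ddE.
  exists ((m + xi v) / 2) => [|i]; first lra.
  have mi : p i v <= m by exact: le_bigmax.
  by rewrite ddE lte_fin; lra.
have : \forall y \near x, forall i, (clarke_dd (f i) y v <= c%:E)%E.
  by apply: filter_forall => i; exact: clarke_dd_usc.
move=> /nbhs_ballP[r /= r0 xrc].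
suff : xi v <= c by rewrite leNgt c_xi.
apply: (cvgr_to_le (xi_xi v)).
have r20 : 0 < r / 2 by rewrite divr_gt0.
have x_near := @cvgr_dist_lt _ _ _ _ _ _ _ x_x _ r20.
have eps_near := @cvgr0_norm_lt _ _ _ _ _ _ eps0 _ r20.
near=> j; apply: goldstein_family_le (xi_in j) => i y xjy; apply: xrc.
rewrite -ball_normE /= -(subrKA (x_ j)) (le_lt_trans (ler_normD _ _))// (splitr r).
apply: ltr_leD; first by near: j; exact: x_near.
apply: (le_trans xjy); apply: (le_trans (ler_norm _)); apply: ltW; near: j.
exact: eps_near.
Unshelve. all: by end_near. Qed.

Lemma convex_hull_sub_goldstein0 k (f : 'I_k -> V -> R) (x : V) :
  convex_hull (\bigcup_i clarke_subdiff (f i) x) `<=` goldstein_family f 0 x.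
Proof.
move=> xi hxi; apply: subset_closure; move: xi hxi.
apply: smallest_sub; first exact: convex_hull_convex.
move=> xi [i _ fxi]; apply: sub_gen_smallest; exists i => //.
apply: subset_closure; apply: sub_gen_smallest; exists x => //.
by rewrite /closed_ball_ /= subrr normr0.
Qed.

End clarke_hull.

Theorem theorem3p5 (R : realType) (H : completeNormedModType R)
  (dot : {dot H for idfun}) (normr_dot : forall u : H, `|u| ^+ 2 = dot u u)
  (k : nat) (f : 'I_k -> H -> R) (x : H)
  (f_lip : forall i, locally_lipschitz (f i) x)
  (eps : nat -> R) (eps_gt0 : forall j, 0 < eps j)
  (eps_cvg : eps j @[j --> \oo] --> 0)
  (x_ : nat -> H) (x_cvg : x_ j @[j --> \oo] --> x)
  (xi_ : nat -> dual H) (xi : dual H) (xi_cvg : weak_cvg xi_ xi)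
  (xi_in : forall j, goldstein_family f (eps j) (x_ j) (xi_ j)) :
  goldstein_family f 0 x xi /\
  goldstein_family f 0 x = convex_hull (\bigcup_i clarke_subdiff (f i) x).
Proof.
have F0E : goldstein_family f 0 x = convex_hull (\bigcup_i clarke_subdiff (f i) x).
  apply/seteqP; split; last exact: convex_hull_sub_goldstein0.
  move=> eta eta_in.
  apply: (@goldstein_family_limit _ _ _ _ _ (fun=> 0) (fun=> x) (fun=> eta)) => //.
  - exact: cvg_cst.
  - exact: cvg_cst.
  - by move=> v; exact: cvg_cst.
split=> //; rewrite F0E; apply: goldstein_family_limit xi_in => // v.
have [ev evE] := exists_dual_eval v.
by have := xi_cvg ev; rewrite evE; under eq_fun do rewrite evE.
Qed.
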